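(* Let $n\ge3$ and suppose the constants $\lambda$ and $\sigma$ satisfy $$\lambda>\frac{n}{n-2}\quad\text{and}\quad\sigma<\frac{2}{n-2}+\frac{n}{n-2}\frac1\lambda,$$ and $\psi:(0,1)\to(0,1)$ is a continuous function satisfying $\lim_{r\to0^+}\psi(r)=0$. Then there exist $C^\infty$ positive solutions $u(x)$ and $v(x)$ of the system $$0\le-\Delta u\le v^\lambda,\qquad 0\le-\Delta v\le u^\sigma\qquad\text{in }\mathbb{R}^n\setminus\{0\}$$ such that $$u(x)\ne O\left(\psi(|x|)\,|x|^{-\frac{(n-2)^2}{n}\lambda}\right)\quad\text{as }x\to0$$ and $$v(x)|x|^{n-2}\to1\quad\text{as }x\to0.$$
   Context: The notation $u(x)\ne O(k(x))$ as $x\to 0$ means that the statement ''$u(x)=O(k(x))$ as $x\to0$'' is false. *)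

(* Defs.v *)
From mathcomp Require Import all_boot all_order all_algebra.
From mathcomp Require Import all_classical all_reals all_analysis.

Set Implicit Arguments.
Unset Strict Implicit.
Unset Printing Implicit Defensive.

Import Order.TTheory GRing.Theory Num.Theory.
Import numFieldNormedType.Exports.

Local Open Scope classical_set_scope.
Local Open Scope ring_scope.

(* The canonical norm [`|x|] of ['rV[R]_n] is the sup norm; [enorm] is |x|.   *)
Definition enorm (R : realType) (n : nat) (x : 'rV[R]_n) : R :=
  Num.sqrt (\sum_(i < n) x ord0 i ^+ 2).

Definition partial (R : realType) (n : nat) (i : 'I_n) (f : 'rV[R]_n -> R)
    : 'rV[R]_n -> R :=
  fun x => 'D_(delta_mx ord0 i) f x.

Definition iter_partial (R : realType) (n : nat) (s : seq 'I_n)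
    (f : 'rV[R]_n -> R) : 'rV[R]_n -> R :=
  foldr (@partial R n) f s.

(* [derive] is a junk value where the limit of difference quotients does not  *)
(* exist, so the existence of each partial derivative is required explicitly. *)
(* [D] is meant to be open; the values of [f] outside [D] are then irrelevant. *)
Definition smooth_on (R : realType) (n : nat) (D : set 'rV[R]_n)
    (f : 'rV[R]_n -> R) : Prop :=
  forall (s : seq 'I_n) (x : 'rV[R]_n), D x ->
    {for x, continuous (iter_partial s f)} /\
    forall i : 'I_n, derivable (iter_partial s f) x (delta_mx ord0 i).

Definition laplacian (R : realType) (n : nat) (f : 'rV[R]_n -> R)
    : 'rV[R]_n -> R :=
  fun x => \sum_(i < n) partial i (partial i f) x.

(* Main.v *)
Require Import Defs.
From mathcomp Require Import all_boot all_order all_algebra.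
From mathcomp Require Import all_classical all_reals all_analysis.
From mathcomp Require Import ring lra.

Set Implicit Arguments.
Unset Strict Implicit.
Unset Printing Implicit Defensive.

Import Order.TTheory GRing.Theory Num.Theory.
Import numFieldNormedType.Exports.

Local Open Scope classical_set_scope.
Local Open Scope ring_scope.

(** Take [v x = 1 + |x|^(2-n)], which is harmonic off the origin and satisfies
    [v x * |x|^(n-2) -> 1].  Then [- laplacian v = 0], so the second pair of
    inequalities is immediate, and everything is about finding a
    superharmonic [u] with [- laplacian u <= v^lambda] and large values along
    a sequence tending to the origin.

    With [b = (n-2)/2], a bubble [(rho + |x-c|^2)^(-b)] is smooth and
    superharmonic, and
    [- laplacian = n (n-2) rho (rho + |x-c|^2)^(-b-2)
                <= n (n-2) (rho + |x-c|^2)^(-n/2)].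
    Let [u] be the sum over [j] of [eps_j] times the bubble at a point [c_j]
    with [|c_j| = d_j], [eps_j] proportional to [2^-j] and
    [rho_j = d_j^(4 b lambda / n)].  Up to the weights this is the smallest
    [rho_j] that keeps the source below [v^lambda] near [c_j], as its height is
    of order [rho_j^(-n/2) = |c_j|^(-(n-2) lambda)]; away from [c_j] the source
    is at most of order [|x|^(-n)], which is dominated by [v^lambda] because
    [(n-2) lambda > n] ([bubble_laplacian_bound]).  At its centre the bubble has
    height [rho_j^(-b) = |c_j|^(-(n-2)^2 lambda / n)], so [u (c_j)] is at least a
    constant times [2^-j |c_j|^(-(n-2)^2 lambda / n)].  As [psi] tends to [0],
    the [d_j] can be chosen with [psi d_j <= 4^-j], which rules out the bound
    [u = O(psi(|x|) |x|^(-(n-2)^2 lambda / n))] ([bubble_superposition]).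

    Smoothness of the infinite sum comes from bounds on all derivatives of a
    bubble that do not depend on [rho] and [c] as long as [rho + |x-c|^2] stays
    away from [0].  Partial derivatives of bubbles are sums of products of
    constants, linear forms and powers of [rho + |y|^2], so they are represented
    by syntactic expressions ([rexpr]) with a symbolic derivative ([rdir]);
    bounds follow by induction on expressions, the mean value theorem turns them
    into Lipschitz and second-order Taylor estimates, and these estimates can be
    summed over [j] ([superpose_continuous], [superpose_is_derive]). *)

(** * Euclidean scalar product and sup norm *)

Definition dot (R : realType) (n : nat) (a b : 'rV[R]_n) : R :=
  \sum_(i < n) a ord0 i * b ord0 i.

Lemma dotDr (R : realType) (n : nat) (a b c : 'rV[R]_n) :
  dot a (b + c) = dot a b + dot a c.
Proof. by rewrite -big_split/=; apply: eq_bigr => i _; rewrite mxE mulrDr. Qed.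

Lemma dotZr (R : realType) (n : nat) (h : R) (a b : 'rV[R]_n) :
  dot a (h *: b) = h * dot a b.
Proof. by rewrite mulr_sumr; apply: eq_bigr => i _; rewrite mxE mulrCA. Qed.

Lemma dotC (R : realType) (n : nat) (a b : 'rV[R]_n) : dot a b = dot b a.
Proof. by apply: eq_bigr => i _; rewrite mulrC. Qed.

Lemma dot_delta (R : realType) (n : nat) (i : 'I_n) (y : 'rV[R]_n) :
  dot (delta_mx ord0 i) y = y ord0 i.
Proof.
rewrite /dot (bigD1 i)//= mxE !eqxx mul1r big1 ?addr0// => j ji.
by rewrite mxE (negbTE ji) andbF mul0r.
Qed.

Lemma dot_ge0 (R : realType) (n : nat) (y : 'rV[R]_n) : 0 <= dot y y.
Proof. by apply: sumr_ge0 => i _; rewrite -expr2 sqr_ge0. Qed.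

Lemma dot_gt0 (R : realType) (n : nat) (y : 'rV[R]_n) : y != 0 -> 0 < dot y y.
Proof.
move=> y0; rewrite lt_neqAle dot_ge0 andbT eq_sym; apply: contra y0 => /eqP h.
apply/eqP/rowP => i; rewrite mxE; apply/eqP; rewrite -sqrf_eq0 expr2.
by apply/eqP/(psumr_eq0P _ h) => // j _; rewrite -expr2 sqr_ge0.
Qed.

Lemma entry_le_norm (R : realType) (n : nat) (y : 'rV[R]_n) (i : 'I_n) :
  `|y ord0 i| <= `|y|.
Proof.
rewrite [leRHS]/Num.norm /= mx_normrE.
by apply/bigmax_geP; right => /=; exists (ord0, i).
Qed.

Lemma norm_delta_le1 (R : realType) (n : nat) (i : 'I_n) :
  `|delta_mx ord0 i : 'rV[R]_n| <= 1.
Proof.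
rewrite [leLHS]/Num.norm /= mx_normrE; apply/bigmax_leP; split => // -[k j] _ /=.
by rewrite mxE; case: (_ && _); rewrite ?normr1 ?normr0.
Qed.

Lemma dot_le_norm (R : realType) (n : nat) (a b : 'rV[R]_n) :
  `|dot a b| <= n%:R * `|a| * `|b|.
Proof.
apply: (le_trans (ler_norm_sum _ _ _)).
rewrite -mulrA mulr_natl -[X in _ *+ X]card_ord -sumr_const.
by apply: ler_sum => i _; rewrite normrM ler_pM ?entry_le_norm.
Qed.

Lemma sqr_norm_le_dot (R : realType) (n : nat) (y : 'rV[R]_n) :
  `|y| ^+ 2 <= dot y y.
Proof.
have [->|y0] := eqVneq `|y| 0; first by rewrite expr0n/= dot_ge0.
have [[k i]] := mx_norm_neq0 y0; rewrite [`|y|]/Num.norm /= => ->.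
rewrite (ord1 k) -normrX ger0_norm ?sqr_ge0//.
rewrite /dot (bigD1 i)//= -expr2 lerDl.
by apply: sumr_ge0 => j _; rewrite -expr2 sqr_ge0.
Qed.

(** * Symbolic calculus for radial powers *)

(** The smallest family of functions of [y] that contains the bubbles
    [(rho + |y|^2)^a] and is stable under differentiation.  The parameter [rho]
    is left out of the syntax, so that one expression, hence one induction,
    covers all values of [rho] at once. *)
Inductive rexpr (R : realType) (n : nat) : Type :=
| RConst of R
| RLin of 'rV[R]_n
| RPow of R
| RAdd of rexpr R n & rexpr R n
| RMul of rexpr R n & rexpr R n.

Arguments RConst {R n}.
Arguments RLin {R n}.
Arguments RPow {R n}.

Fixpoint reval (R : realType) (n : nat) (e : rexpr R n) (rho : R)
    (y : 'rV[R]_n) : R :=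
  match e with
  | RConst c => c
  | RLin a => dot a y
  | RPow a => (rho + dot y y) `^ a
  | RAdd e1 e2 => reval e1 rho y + reval e2 rho y
  | RMul e1 e2 => reval e1 rho y * reval e2 rho y
  end.

Fixpoint rdir (R : realType) (n : nat) (w : 'rV[R]_n) (e : rexpr R n)
    : rexpr R n :=
  match e with
  | RConst c => RConst 0
  | RLin a => RConst (dot a w)
  | RPow a => RMul (RMul (RConst (2 * a)) (RLin w)) (RPow (a - 1))
  | RAdd e1 e2 => RAdd (rdir w e1) (rdir w e2)
  | RMul e1 e2 => RAdd (RMul (rdir w e1) e2) (RMul e1 (rdir w e2))
  end.

(** The set on which expressions are bounded uniformly in [rho]: exponents may be
    negative, so [rho + |y|^2] has to be bounded away from [0] as well. *)
Definition tame (R : realType) (n : nat) (delta M rho : R) (y : 'rV[R]_n) :=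
  `|y| <= M /\ delta <= rho + dot y y <= M.

(** The power is monotone in [t], in a direction that depends on the sign of
    [a]; adding the values at both ends avoids distinguishing the two cases
    later. *)
Lemma powR_le_endpoints (R : realType) (delta M t a : R) :
  0 < delta -> delta <= t <= M -> t `^ a <= delta `^ a + M `^ a.
Proof.
move=> d0 /andP[dt tM]; have t0 := lt_le_trans d0 dt.
have [a0|a0] := leP 0 a.
  rewrite (le_trans (ge0_ler_powR a0 _ _ tM)) ?nnegrE ?(ltW t0)//.
    exact: le_trans (ltW t0) tM.
  by rewrite lerDr powR_ge0.
rewrite -[a]opprK ![_ `^ (- - a)]powRN (@le_trans _ _ (delta `^ (- a))^-1)//.
  rewrite lef_pV2 ?posrE ?powR_gt0//; apply: ge0_ler_powR => //.
  - by rewrite oppr_ge0 ltW.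
  - by rewrite nnegrE ltW.
  - by rewrite nnegrE ltW.
by rewrite lerDl invr_ge0 powR_ge0.
Qed.

Lemma reval_bounded (R : realType) (n : nat) (e : rexpr R n) (delta M : R) :
  0 < delta -> exists C, forall rho y, tame delta M rho y ->
    `|reval e rho y| <= C.
Proof.
move=> d0; elim: e => [c|a|a|e1 [C1 h1] e2 [C2 h2]|e1 [C1 h1] e2 [C2 h2]] /=.
- by exists `|c|.
- exists (n%:R * `|a| * M) => rho y [yM _].
  by rewrite (le_trans (dot_le_norm _ _))// ler_wpM2l// mulr_ge0.
- exists (delta `^ a + M `^ a) => rho y [_ yt].
  by rewrite ger0_norm ?powR_ge0//; exact: (powR_le_endpoints _ d0 yt).
- exists (C1 + C2) => rho y yt.
  by rewrite (le_trans (ler_normD _ _))// lerD ?h1 ?h2.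
- exists (C1 * C2) => rho y yt.
  by rewrite normrM ler_pM ?h1 ?h2.
Qed.

(** The constant is independent of the direction [w], which is what makes a
    Lipschitz bound in all directions possible. *)
Lemma reval_rdir_bounded (R : realType) (n : nat) (e : rexpr R n)
    (delta M : R) :
  0 < delta -> exists C, forall rho y w, tame delta M rho y ->
    `|reval (rdir w e) rho y| <= C * `|w|.
Proof.
move=> d0; elim: e => [c|a|a|e1 [C1 h1] e2 [C2 h2]|e1 [C1 h1] e2 [C2 h2]] /=.
- by exists 0 => *; rewrite normr0 mul0r.
- by exists (n%:R * `|a|) => *; rewrite dot_le_norm.
- exists (`|2 * a| * (n%:R * M) * (delta `^ (a - 1) + M `^ (a - 1))).
  move=> rho y w [yM yt].
  rewrite [leRHS]mulrAC normrM ler_pM//; last first.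
    by rewrite ger0_norm ?powR_ge0//; exact: (powR_le_endpoints _ d0 yt).
  rewrite normrM -mulrA ler_wpM2l// (le_trans (dot_le_norm _ _))//.
  by rewrite mulrAC ler_wpM2r// ler_wpM2l.
- exists (C1 + C2) => rho y w yt.
  by rewrite (le_trans (ler_normD _ _))// mulrDl lerD ?h1 ?h2.
- have [B1 b1] := reval_bounded e1 M d0.
  have [B2 b2] := reval_bounded e2 M d0.
  exists (C1 * B2 + B1 * C2) => rho y w yt.
  rewrite (le_trans (ler_normD _ _))// mulrDl lerD//.
    by rewrite normrM mulrAC ler_pM ?h1 ?b2.
  by rewrite normrM -mulrA ler_pM ?b1 ?h2.
Qed.

Lemma reval_rdirZ (R : realType) (n : nat) (e : rexpr R n) (h rho : R)
    (w y : 'rV[R]_n) :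
  reval (rdir (h *: w) e) rho y = h * reval (rdir w e) rho y.
Proof.
elim: e => [c|a|a|e1 h1 e2 h2|e1 h1 e2 h2] /=.
- by rewrite mulr0.
- by rewrite dotZr.
- by rewrite (dotC (h *: w)) dotZr (dotC y w); ring.
- by rewrite h1 h2 mulrDr.
- by rewrite h1 h2; ring.
Qed.

Lemma is_derive_dot_line (R : realType) (n : nat) (a x w : 'rV[R]_n) (t : R) :
  is_derive t (1 : R) (fun t : R => dot a (x + t *: w)) (dot a w).
Proof.
rewrite (_ : (fun t : R => _) = cst (dot a x) + dot a w *: id); last first.
  by apply/funext => s; rewrite dotDr dotZr mulrC.
by apply: is_derive_eq; rewrite add0r /GRing.scale/= mulr1.
Qed.

Lemma is_derive_sq_line (R : realType) (n : nat) (rho : R) (x w : 'rV[R]_n)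
    (t : R) :
  is_derive t (1 : R)
    (fun t : R => rho + dot (x + t *: w) (x + t *: w))
    (2 * dot w (x + t *: w)).
Proof.
rewrite (_ : (fun t : R => _) =
  cst (rho + dot x x) + ((2 * dot w x) *: id + dot w w *: (id * id)));
  last first.
  apply/funext => s; rewrite !(dotDr, dotZr) !(dotC (x + _)).
  by rewrite !(dotDr, dotZr) (dotC x w) !fctE /GRing.scale/=; ring.
have D := is_derive_id t (1 : R).
have := is_deriveD (is_derive_cst (rho + dot x x) t 1)
  (is_deriveD (is_deriveZ (2 * dot w x) D)
     (is_deriveZ (dot w w) (is_deriveM D D))).
move=> H; apply: (is_derive_eq H).
by rewrite dotDr dotZr add0r /GRing.scale/=; ring.
Qed.

(** Restricting to a line reduces the calculus to functions of one real
    variable, which is all that the mean value theorem needs. *)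
Lemma is_derive_reval_line (R : realType) (n : nat) (e : rexpr R n) (rho : R)
    (x w : 'rV[R]_n) (t : R) :
  0 < rho + dot (x + t *: w) (x + t *: w) ->
  is_derive t (1 : R) (fun t : R => reval e rho (x + t *: w))
    (reval (rdir w e) rho (x + t *: w)).
Proof.
move=> p0; elim: e => [c|a|a|e1 h1 e2 h2|e1 h1 e2 h2] /=.
- exact: is_derive_cst.
- exact: is_derive_dot_line.
- have D := @is_derive1_comp R (@powR R ^~ a)
    (fun t => rho + dot (x + t *: w) (x + t *: w)) t _ _
    (is_derive1_powR a p0) (is_derive_sq_line rho x w t).
  by apply: (is_derive_eq D); ring.
- exact: is_deriveD.
- apply: (is_derive_eq (is_deriveM h1 h2)).
  by rewrite /GRing.scale/=; ring.
Qed.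

Lemma reval_mvt (R : realType) (n : nat) (e : rexpr R n) (rho : R)
    (x w : 'rV[R]_n) :
  (forall t : R, 0 <= t <= 1 -> 0 < rho + dot (x + t *: w) (x + t *: w)) ->
  exists2 t : R, 0 <= t <= 1 &
    reval e rho (x + w) - reval e rho x = reval (rdir w e) rho (x + t *: w).
Proof.
move=> p0.
have D (t : R) : 0 <= t <= 1 -> is_derive t (1 : R)
    (fun t : R => reval e rho (x + t *: w))
    (reval (rdir w e) rho (x + t *: w)).
  by move=> /p0; exact: is_derive_reval_line.
have [t|t t01|t t01] := @MVT_segment R
    (fun t : R => reval e rho (x + t *: w))
    (fun t : R => reval (rdir w e) rho (x + t *: w)) 0 1 ler01.
- by rewrite in_itv/= => /andP[t0 t1]; apply: D; rewrite !ltW.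
- apply: derivable_within_continuous => s; rewrite in_itv/= => s01.
  by have [] := D s s01.
- rewrite subr0 mulr1 scale1r scale0r addr0 => ->.
  by exists t => //; move: t01; rewrite in_itv.
Qed.

(** * Uniform Lipschitz and Taylor estimates *)

Lemma reval_lipschitz (R : realType) (n : nat) (e : rexpr R n) (delta M : R) :
  0 < delta -> exists C : R, forall (rho : R) (x w : 'rV[R]_n),
    (forall t : R, 0 <= t <= 1 -> tame delta M rho (x + t *: w)) ->
    `|reval e rho (x + w) - reval e rho x| <= C * `|w|.
Proof.
move=> d0; have [C hC] := reval_rdir_bounded e M d0.
exists C => rho x w xw; have [t t01|t t01 ->] := @reval_mvt R n e rho x w.
  by have [_ /andP[+ _]] := xw t t01; exact: lt_le_trans.
exact/hC/xw.
Qed.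

(** By the mean value theorem the increment is [h] times the directional
    derivative at an intermediate point, and that derivative is itself given by
    an expression, hence Lipschitz. *)
Lemma reval_taylor (R : realType) (n : nat) (e : rexpr R n) (delta M : R)
    (w : 'rV[R]_n) :
  0 < delta -> exists C : R, forall (rho : R) (x : 'rV[R]_n) (h : R),
    (forall t : R, 0 <= t <= 1 -> tame delta M rho (x + t *: (h *: w))) ->
    `|reval e rho (x + h *: w) - reval e rho x - h * reval (rdir w e) rho x|
      <= C * h ^+ 2.
Proof.
move=> d0; have [C hC] := reval_lipschitz (rdir w e) M d0.
exists (`|C| * `|w|) => rho x h xw.
have [t t01|t t01 ->] := @reval_mvt R n e rho x (h *: w).
  by have [_ /andP[+ _]] := xw t t01; exact: lt_le_trans.
rewrite reval_rdirZ -mulrBr normrM.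
have /hC hE : forall s : R, 0 <= s <= 1 ->
    tame delta M rho (x + s *: (t *: (h *: w))).
  move=> s s01; rewrite scalerA; apply: xw.
  by case/andP: t01 => t0 t1; case/andP: s01 => s0 s1; rewrite mulr_ge0//= mulr_ile1.
rewrite (le_trans (ler_wpM2l (normr_ge0 h) hE))//.
rewrite !normrZ -(real_normK (num_real h)) expr2.
rewrite (_ : `|h| * _ = C * (`|t| * (`|h| * `|h| * `|w|))); last by ring.
rewrite (_ : `|C| * _ * _ = `|C| * (1 * (`|h| * `|h| * `|w|))); last by ring.
apply: (@le_trans _ _ (`|C| * (`|t| * (`|h| * `|h| * `|w|)))).
  by rewrite ler_wpM2r ?ler_norm// !mulr_ge0.
rewrite ler_wpM2l// ler_wpM2r ?mulr_ge0//.
by case/andP: t01 => t0 t1; rewrite ger0_norm.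
Qed.

(** A quadratic remainder bound survives summation over infinitely many
    functions, whereas a mere limit of difference quotients does not; this turns
    it back into a derivative. *)
Lemma is_derive_of_taylor (R : realType) (V : normedModType R) (f : V -> R)
    (x w : V) (l eta C : R) :
  0 < eta ->
  (forall h : R, `|h| < eta ->
    `|f (x + h *: w) - f x - h * l| <= C * h ^+ 2) ->
  is_derive x w f l.
Proof.
move=> eta0 hC.
have cv : (fun h : R => h^-1 *: (f (h *: w + x) - f x)) @ 0^' --> l.
  apply/cvgrPdist_le => eps eps0.
  near=> h.
  have h0 : h != 0 by near: h; exact: nbhs_dnbhs_neq.
  have -> : l - h^-1 *: (f (h *: w + x) - f x) =
            - (h^-1 * (f (x + h *: w) - f x - h * l)).
    by rewrite [_ + x]addrC /GRing.scale/=; field.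
  rewrite normrN normrM normfV ler_pdivrMl ?normr_gt0//.
  have heta : `|h| < eta by near: h; apply: dnbhs0_lt.
  apply: (le_trans (hC _ heta)).
  rewrite -(real_normK (num_real h)) expr2 mulrA [leRHS]mulrC ler_wpM2r//.
  apply: (@le_trans _ _ ((`|C| + 1) * `|h|)).
    by rewrite ler_wpM2r// (le_trans (ler_norm C))// lerDl.
  rewrite -ler_pdivlMl ?ltr_wpDl// mulrC.
  by near: h; apply: dnbhs0_le; rewrite divr_gt0// ltr_wpDl.
apply: DeriveDef; first by apply/cvg_ex; exists l.
exact: cvg_lim cv.
Unshelve. all: by end_near. Qed.

Lemma continuous_of_lipschitz (R : realType) (V : normedModType R) (f : V -> R)
    (x : V) (eta C : R) :
  0 < eta ->
  (forall w : V, `|w| < eta -> `|f (x + w) - f x| <= C * `|w|) ->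
  {for x, continuous f}.
Proof.
move=> eta0 hC; apply/cvgrPdist_le => eps eps0; near=> y.
have -> : y = x + (y - x) by rewrite addrCA subrr addr0.
have hy : `|y - x| < eta.
  rewrite distrC; near: y; exact: cvgr_dist_lt.
rewrite distrC (le_trans (hC _ hy))//.
apply: (@le_trans _ _ ((`|C| + 1) * `|y - x|)).
  by rewrite ler_wpM2r// (le_trans (ler_norm C))// lerDl.
rewrite -ler_pdivlMl ?ltr_wpDl// mulrC distrC.
by near: y; apply: cvgr_dist_le => //; rewrite divr_gt0// ltr_wpDl.
Unshelve. all: by end_near. Qed.

(** * Families of functions closed under differentiation *)

(** [d i] computes derivatives on indices only inside [D]; as [D] is open the
    identity holds near each point, so it can be differentiated again. *)
Lemma iter_partial_family (R : realType) (n : nat) (E : Type)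
    (F : E -> 'rV[R]_n -> R) (d : 'I_n -> E -> E) (D : set 'rV[R]_n) :
  open D ->
  (forall e i x, D x -> is_derive x (delta_mx ord0 i) (F e) (F (d i e) x)) ->
  forall (s : seq 'I_n) e x, D x ->
    iter_partial s (F e) x = F (foldr d e s) x.
Proof.
move=> oD dF; elim=> [//|i s IH] e x Dx /=.
rewrite /partial (@near_eq_derive _ _ _ _ (F (foldr d e s))).
  by have [_ ->] := dF (foldr d e s) i x Dx.
by near do apply: IH; apply: open_nbhs_nbhs.
Unshelve. all: by end_near. Qed.

Lemma smooth_on_family (R : realType) (n : nat) (E : Type)
    (F : E -> 'rV[R]_n -> R) (d : 'I_n -> E -> E) (D : set 'rV[R]_n) :
  open D ->
  (forall e x, D x -> {for x, continuous (F e)}) ->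
  (forall e i x, D x -> is_derive x (delta_mx ord0 i) (F e) (F (d i e) x)) ->
  forall e, smooth_on D (F e).
Proof.
move=> oD cF dF e s x Dx.
have near_eq : \forall y \near x, F (foldr d e s) y = iter_partial s (F e) y.
  apply: filterS (open_nbhs_nbhs (conj oD Dx)) => y Dy.
  exact/esym/(iter_partial_family oD dF).
split=> [|i].
  have eqx := nbhs_singleton near_eq.
  rewrite /prop_for /continuous_at -eqx.
  exact: cvg_trans (near_eq_cvg near_eq) (cF _ _ Dx).
apply: (near_eq_derivable near_eq).
by have [] := dF (foldr d e s) i x Dx.
Qed.

(** * Superposition of bubbles *)

(** Near [x], one pair of constants serves for all translates and all
    parameters. *)

Definition uniformly_tame (R : realType) (n : nat) (I : Type) (rho : I -> R)
    (c : I -> 'rV[R]_n) (x : 'rV[R]_n) : Prop :=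
  exists eta delta M : R, [/\ 0 < eta, 0 < delta &
    forall (i : I) (w : 'rV[R]_n), `|w| < eta ->
      tame delta M (rho i) (x + w - c i)].

(** Each bubble is far from its singularity near [x], either because [rho i] is
    not small or because its centre is not close to [x]. *)
Lemma uniformly_tame_separated (R : realType) (n : nat) (I : Type)
    (rho : I -> R) (c : I -> 'rV[R]_n) (x : 'rV[R]_n) (r : R) :
  0 < r -> (forall i, 0 <= rho i <= 1) -> (forall i, `|c i| <= 1) ->
  (forall i, r <= rho i \/ r <= `|x - c i|) ->
  uniformly_tame rho c x.
Proof.
move=> r0 rho01 c1 sep.
pose K := `|x| + r + 1.
have K0 : 0 <= K by rewrite !addr_ge0// ltW.
exists (r / 2), (Num.min r ((r / 2) ^+ 2)), (K + (1 + n%:R * K * K)).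
have r20 : 0 < r / 2 by rewrite divr_gt0.
split=> [//||i w wr]; first by rewrite lt_min r0 exprn_gt0.
have /andP[rho0 rho1] := rho01 i.
have yK : `|x + w - c i| <= K.
  rewrite (le_trans (ler_normB _ _))// lerD ?c1//.
  rewrite (le_trans (ler_normD _ _))// lerD// (le_trans (ltW wr))//.
  by rewrite ler_pdivrMr// mulr_natr mulr2n lerDl ltW.
split; first by rewrite (le_trans yK)// lerDl !addr_ge0// !mulr_ge0.
apply/andP; split.
  rewrite ge_min; case: (sep i) => [rr|rx]; apply/orP.
    by left; rewrite (le_trans rr)// lerDl dot_ge0.
  right; rewrite (@le_trans _ _ (`|x + w - c i| ^+ 2))//; last first.
    by rewrite (le_trans (sqr_norm_le_dot _))// lerDr.
  rewrite ler_pXn2r ?nnegrE ?(ltW r20)//.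
  have : `|x - c i| <= `|x + w - c i| + `|w|.
    by rewrite -{1}(addrK w x) addrAC; exact: ler_normB.
  by move: wr rx; lra.
rewrite -[leLHS]add0r lerD// lerD//.
rewrite (le_trans (ler_norm _))// (le_trans (dot_le_norm _ _))//.
by rewrite ler_pM ?mulr_ge0// ler_wpM2l.
Qed.

Lemma uniformly_tame_lipschitz (R : realType) (n : nat) (I : Type)
    (rho : I -> R) (c : I -> 'rV[R]_n) (x : 'rV[R]_n) (e : rexpr R n) :
  uniformly_tame rho c x ->
  exists eta C : R, 0 < eta /\ forall i (w : 'rV[R]_n), `|w| < eta ->
    `|reval e (rho i) (x + w - c i) - reval e (rho i) (x - c i)| <= C * `|w|.
Proof.
move=> [eta [delta [M [eta0 delta0 tm]]]].
have [C hC] := reval_lipschitz e M delta0.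
exists eta, C; split=> // i w weta; rewrite addrAC; apply: hC => t /andP[t0 t1].
rewrite addrAC; apply: tm; apply: le_lt_trans weta.
by rewrite normrZ ger0_norm// ler_piMl.
Qed.

Lemma uniformly_tame_taylor (R : realType) (n : nat) (I : Type)
    (rho : I -> R) (c : I -> 'rV[R]_n) (x : 'rV[R]_n) (e : rexpr R n)
    (k : 'I_n) :
  uniformly_tame rho c x ->
  exists eta C : R, 0 < eta /\ forall i (h : R), `|h| < eta ->
    `|reval e (rho i) (x + h *: delta_mx ord0 k - c i)
       - reval e (rho i) (x - c i)
       - h * reval (rdir (delta_mx ord0 k) e) (rho i) (x - c i)|
      <= C * h ^+ 2.
Proof.
move=> [eta [delta [M [eta0 delta0 tm]]]].
have [C hC] := reval_taylor e M (delta_mx ord0 k) delta0.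
exists eta, C; split; first exact: eta0.
move=> i h heta; rewrite (addrAC x).
apply: hC => t /andP[t0 t1].
rewrite (addrAC x); apply: tm; apply: le_lt_trans heta.
rewrite !normrZ (ger0_norm t0) -[leRHS]mul1r ler_pM// ler_piMr//.
exact: norm_delta_le1.
Qed.

Lemma uniformly_tame_bounded (R : realType) (n : nat) (I : Type)
    (rho : I -> R) (c : I -> 'rV[R]_n) (x : 'rV[R]_n) (e : rexpr R n) :
  uniformly_tame rho c x ->
  exists C : R, forall i, `|reval e (rho i) (x - c i)| <= C.
Proof.
move=> [eta [delta [M [eta0 delta0 tm]]]].
have [C hC] := reval_bounded e M delta0.
exists C => i; apply: hC; rewrite -[x in x - _]addr0; apply: tm.
by rewrite normr0.
Qed.

(** Weierstrass test, with the bound on the sum that comes with it. *)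
Lemma dominated_series (R : realType) (a eps : nat -> R) (C : R) :
  (forall j, 0 <= eps j) -> (forall j, `|a j| <= C * eps j) ->
  cvgn (series eps) ->
  cvgn (series a) /\ `|limn (series a)| <= C * limn (series eps).
Proof.
move=> eps0 aC ceps.
have cC : cvgn (series (C *: eps)) by exact: is_cvg_seriesZ.
have na : cvgn [normed series a].
  apply: (series_le_cvg _ _ _ cC) => j //=.
  exact: le_trans (aC j).
split; first exact: normed_cvg na.
apply: (le_trans (lim_series_norm na)).
rewrite -[leRHS](lim_seriesZ C ceps).
exact: lim_series_le na cC aC.
Qed.

Definition superpose (R : realType) (n : nat) (eps rho : nat -> R)
    (c : nat -> 'rV[R]_n) (e : rexpr R n) (x : 'rV[R]_n) : R :=
  limn (series (fun j => eps j * reval e (rho j) (x - c j))).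

Lemma superpose_cvg (R : realType) (n : nat) (eps rho : nat -> R)
    (c : nat -> 'rV[R]_n) (e : rexpr R n) (x : 'rV[R]_n) :
  (forall j, 0 <= eps j) -> cvgn (series eps) -> uniformly_tame rho c x ->
  cvgn (series (fun j => eps j * reval e (rho j) (x - c j))).
Proof.
move=> eps0 ceps /(uniformly_tame_bounded e)[C hC].
have := @dominated_series R (fun j => eps j * reval e (rho j) (x - c j)) eps C.
case=> // j; rewrite normrM (ger0_norm (eps0 j)) mulrC.
by rewrite ler_wpM2r.
Qed.

(** Each of the bounds that are uniform in [j] gets multiplied by the sum of the
    weights [eps]. *)
Lemma superpose_continuous (R : realType) (n : nat) (eps rho : nat -> R)
    (c : nat -> 'rV[R]_n) (e : rexpr R n) (x : 'rV[R]_n) :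
  (forall j, 0 <= eps j) -> cvgn (series eps) ->
  (\forall y \near x, uniformly_tame rho c y) ->
  {for x, continuous (superpose eps rho c e)}.
Proof.
move=> eps0 ceps tm.
have [eta [C [eta0 hC]]] := uniformly_tame_lipschitz e (nbhs_singleton tm).
move: (tm) => /nbhs_normP[r /= r0 hr].
pose eta' := Num.min eta r.
apply: (@continuous_of_lipschitz _ _ _ _ eta' (C * limn (series eps))).
  by rewrite lt_min eta0.
move=> w; rewrite lt_min => /andP[weta wr].
have tmw : uniformly_tame rho c (x + w).
  by apply: hr; rewrite /= opprD addNKr normrN.
have cx := superpose_cvg (e:=e) eps0 ceps (nbhs_singleton tm).
have cw := superpose_cvg (e:=e) eps0 ceps tmw.
rewrite /superpose -(lim_seriesB cw cx) mulrAC.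
apply: (dominated_series eps0 _ ceps).2 => j.
rewrite /= -mulrBr normrM (ger0_norm (eps0 j)) mulrC ler_wpM2r//.
exact: hC.
Qed.

Lemma superpose_is_derive (R : realType) (n : nat) (eps rho : nat -> R)
    (c : nat -> 'rV[R]_n) (e : rexpr R n) (k : 'I_n) (x : 'rV[R]_n) :
  (forall j, 0 <= eps j) -> cvgn (series eps) ->
  (\forall y \near x, uniformly_tame rho c y) ->
  is_derive x (delta_mx ord0 k) (superpose eps rho c e)
    (superpose eps rho c (rdir (delta_mx ord0 k) e) x).
Proof.
move=> eps0 ceps tm.
have [eta [C [eta0 hC]]] := uniformly_tame_taylor e k (nbhs_singleton tm).
move: (tm) => /nbhs_normP[r /= r0 hr].
apply: (@is_derive_of_taylor _ _ _ _ _ _ (Num.min eta r)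
  (C * limn (series eps))).
  by rewrite lt_min eta0.
move=> h; rewrite lt_min => /andP[heta hr'].
have tmw : uniformly_tame rho c (x + h *: delta_mx ord0 k).
  apply: hr; rewrite /= opprD addNKr normrN normrZ.
  by rewrite (le_lt_trans _ hr')// ler_piMr// norm_delta_le1.
have cx := superpose_cvg (e:=e) eps0 ceps (nbhs_singleton tm).
have cw := superpose_cvg (e:=e) eps0 ceps tmw.
have cd := superpose_cvg (e:=rdir (delta_mx ord0 k) e) eps0 ceps
  (nbhs_singleton tm).
rewrite /superpose -(lim_seriesB cw cx) -[h * _](lim_seriesZ h cd).
rewrite -lim_seriesB; [|exact: is_cvg_seriesB|exact: is_cvg_seriesZ].
rewrite mulrAC; apply: (dominated_series eps0 _ ceps).2 => j.
rewrite (_ : _ j = eps j * (reval e (rho j) (x + h *: delta_mx ord0 k - c j)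
       - reval e (rho j) (x - c j)
       - h * reval (rdir (delta_mx ord0 k) e) (rho j) (x - c j))); last first.
  by rewrite !fctE /GRing.scale/=; ring.
by rewrite normrM (ger0_norm (eps0 j)) mulrC ler_wpM2r// hC.
Qed.

Lemma superpose_sum (R : realType) (n : nat) (eps rho : nat -> R)
    (c : nat -> 'rV[R]_n) (m : nat) (e : 'I_m -> rexpr R n) (x : 'rV[R]_n) :
  (forall j, 0 <= eps j) -> cvgn (series eps) -> uniformly_tame rho c x ->
  \sum_(i < m) superpose eps rho c (e i) x =
  limn (series (fun j => eps j * \sum_(i < m) reval (e i) (rho j) (x - c j))).
Proof.
move=> eps0 ceps tm; apply/esym/cvg_lim => //.
rewrite (_ : series _ = \sum_(i < m)
    series (fun j => eps j * reval (e i) (rho j) (x - c j))); last first.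
  apply/funext => N; rewrite fct_sumE /series/= exchange_big/=.
  by apply: eq_bigr => j _; rewrite mulr_sumr.
elim/big_ind2: _ => [|f1 l1 f2 l2 c1 c2|i _]; first exact: cvg_cst.
  exact: cvgD c1 c2.
exact: superpose_cvg.
Qed.

(** * The Laplacian of a bubble *)

Lemma laplacian_family (R : realType) (n : nat) (E : Type)
    (F : E -> 'rV[R]_n -> R) (d : 'I_n -> E -> E) (D : set 'rV[R]_n) :
  open D ->
  (forall e i x, D x -> is_derive x (delta_mx ord0 i) (F e) (F (d i e) x)) ->
  forall e x, D x -> laplacian (F e) x = \sum_(i < n) F (d i (d i e)) x.
Proof.
move=> oD dF e x Dx; apply: eq_bigr => i _.
exact: (iter_partial_family oD dF [:: i; i]).
Qed.

(** For [a = - (n-2)/2] the coefficient of [dot y y] vanishes: the bubble is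
    superharmonic for [rho > 0], and harmonic for [rho = 0]. *)
Lemma laplacian_RPow (R : realType) (n : nat) (a rho : R) (y : 'rV[R]_n) :
  0 < rho + dot y y ->
  \sum_(i < n) reval (rdir (delta_mx ord0 i) (rdir (delta_mx ord0 i) (RPow a)))
    rho y =
  2 * a * (n%:R * rho + (n%:R + 2 * (a - 1)) * dot y y)
    * (rho + dot y y) `^ (a - 2).
Proof.
move=> B0; set B := rho + dot y y in B0 *.
have Ba : B `^ (a - 1) = B * B `^ (a - 2).
  rewrite -{2}(powRr1 (ltW B0)) -powRD; last by rewrite (gt_eqF B0) implybT.
  by congr powR; ring.
pose S (i : 'I_n) := y ord0 i * y ord0 i.
transitivity (\sum_(i < n) (2 * a * B `^ (a - 1)
    + 4 * a * (a - 1) * B `^ (a - 2) * S i)).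
  apply: eq_bigr => i _ /=; rewrite !dot_delta mxE !eqxx /= -/B.
  by rewrite (_ : a - 1 - 1 = a - 2) /S; ring.
rewrite big_split/= sumr_const card_ord -[_ *+ n]mulr_natl -mulr_sumr.
by rewrite -[\sum_(_ < _) _]/(dot y y) Ba /B; ring.
Qed.

Lemma ler_powRN (R : realType) (x y r : R) :
  0 < x -> x <= y -> 0 <= r -> y `^ (- r) <= x `^ (- r).
Proof.
move=> x0 xy r0; have y0 := lt_le_trans x0 xy.
rewrite !powRN lef_pV2 ?posrE ?powR_gt0//.
by apply: ge0_ler_powR => //; rewrite nnegrE ltW.
Qed.

(** For [s >= 1] the left side is at most [1]; for [s < 1] it is at most
    [s^(-b lambda)], the [lambda]-th power of the second summand. *)
Lemma powR_le_shifted (R : realType) (s b r lambda : R) :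
  0 < s -> 0 <= lambda -> 0 <= r <= b * lambda ->
  s `^ (- r) <= (1 + s `^ (- b)) `^ lambda.
Proof.
move=> s0 l0 /andP[r0 rbl].
have [s1|s1] := leP 1 s.
  apply: (@le_trans _ _ 1).
    by rewrite -[leRHS](powRr0 s) ler_powR// oppr_le0.
  rewrite -[leLHS](powRr0 (1 + s `^ (- b))) ler_powR//.
  by rewrite lerDl powR_ge0.
apply: (@le_trans _ _ (s `^ (- b * lambda))).
  by apply: ger_powR; rewrite ?s0 ?(ltW s1)// mulNr lerN2.
rewrite powRrM; apply: ge0_ler_powR => //; rewrite ?nnegrE ?addr_ge0 ?powR_ge0//.
by rewrite lerDr.
Qed.

(** This is [|x|^2 <= 2 |x-c|^2 + 2 |c|^2], which replaces the triangle
    inequality for the Euclidean norm. *)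
Lemma dot_shift_ge (R : realType) (n : nat) (x c : 'rV[R]_n) :
  dot x x / 2 - dot c c <= dot (x - c) (x - c).
Proof.
rewrite /dot mulr_suml -sumrB; apply: ler_sum => i _; rewrite !mxE.
set a := x ord0 i; set b := c ord0 i.
have h := sqr_ge0 (a - 2 * b).
rewrite -subr_ge0 (_ : _ - _ = (a - 2 * b) ^+ 2 / 2); first exact: divr_ge0.
by field.
Qed.

(** Absorbing the factor [rho] leaves the power [-n/2] of
    [rho + |x-c|^2].  If [|x| <= 2d], then [rho] alone suffices, since
    [rho^(-n/2) = (d^2)^(-b lambda)] was the reason for the choice of [rho].  If
    [|x| > 2d], then [|x-c|^2 >= |x|^2/4], and [|x|^(-n)] is dominated because
    [n/2 <= b lambda]. *)
Lemma bubble_laplacian_bound (R : realType) (n : nat) (b lambda d rho : R)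
    (x c : 'rV[R]_n) :
  (0 < n)%N -> n%:R = 2 * (b + 1) -> 0 <= lambda -> n%:R / 2 <= b * lambda ->
  0 < d -> dot c c = d ^+ 2 -> x != 0 ->
  rho = d `^ (4 * (b * lambda) / n%:R) ->
  rho * (rho + dot (x - c) (x - c)) `^ (- b - 2) <=
    4 `^ (b * lambda) * (1 + dot x x `^ (- b)) `^ lambda.
Proof.
move=> n0 nb l0 nbl d0 cd x0 rhoE; set p := b * lambda in nbl rhoE *.
have N0 : 0 < n%:R :> R by rewrite ltr0n.
have s0 := dot_gt0 x0; set s := dot x x in s0 *.
have rho0 : 0 < rho by rewrite rhoE powR_gt0.
set B := rho + _; have rB : rho <= B by rewrite lerDl dot_ge0.
have B0 : 0 < B by exact: lt_le_trans rB.
have p0 : 0 <= p by rewrite (le_trans _ nbl)// divr_ge0.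
have n20 : 0 <= n%:R / 2 :> R by rewrite divr_ge0.
have -> : - b - 2 = - (n%:R / 2) - 1 by rewrite nb; field.
apply: (@le_trans _ _ (B `^ (- (n%:R / 2)))).
  rewrite powRB; last by rewrite (gt_eqF B0) implybT.
  rewrite (powRr1 (ltW B0)) mulrCA -[leRHS]mulr1 ler_wpM2l ?powR_ge0//.
  by rewrite ler_pdivrMr// mul1r.
(* Both cases compare with a power of [s / 4], the exponent [r] being
   [b * lambda] in the first and [n / 2] in the second. *)
have quarter r : 0 <= r <= p ->
    (s / 4) `^ (- r) <= 4 `^ p * (1 + s `^ (- b)) `^ lambda.
  move=> /[dup] rp /andP[r0 r1].
  rewrite powRM ?invr_ge0 ?(ltW s0)// mulrC ler_pM ?powR_ge0//.
    rewrite -powR_inv1// -powRrM mulN1r opprK.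
    by apply: ler_powR => //; rewrite ler1n.
  exact: powR_le_shifted.
have s40 : 0 < s / 4 by rewrite divr_gt0.
have [sd|ds] := leP s (4 * d ^+ 2).
  apply: (@le_trans _ _ (rho `^ (- (n%:R / 2)))).
    exact: ler_powRN.
  rewrite rhoE -powRrM.
  have -> : 4 * p / n%:R * - (n%:R / 2) = 2%:R * - p.
    by field; rewrite gt_eqF.
  rewrite powRrM powR_mulrn ?(ltW d0)//.
  apply: (le_trans _ (quarter p _)); last by rewrite p0 lexx.
  by apply: ler_powRN => //; rewrite ler_pdivrMr// mulrC.
apply: (le_trans _ (quarter (n%:R / 2) _)); last first.
  by rewrite n20.
apply: ler_powRN => //.
apply: (@le_trans _ _ (dot (x - c) (x - c))); last by rewrite lerDr ltW.
by apply: (le_trans _ (dot_shift_ge x c)); rewrite cd -/s; lra.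
Qed.

Lemma term_le_lim_series (R : realType) (a : nat -> R) (j : nat) :
  (forall i, 0 <= a i) -> cvgn (series a) -> a j <= limn (series a).
Proof.
move=> a0 ca; apply: (@le_trans _ _ (series a j.+1)).
  by rewrite /series/= big_nat_recr//= lerDr sumr_ge0.
by apply: nondecreasing_cvgn_le => //; exact: nondecreasing_series.
Qed.

Lemma finite_lower_bound (R : realType) (rho : nat -> R) (N : nat) :
  (forall j, 0 < rho j) ->
  exists2 r, 0 < r & forall j, (j < N)%N -> r <= rho j.
Proof.
move=> rho0; elim: N => [|N [r r0 hr]]; first by exists 1.
exists (Num.min r (rho N)); first by rewrite lt_min r0 rho0.
move=> j; rewrite ltnS leq_eqVlt ge_min => /predU1P[->|/hr ->//].
by rewrite lexx orbT.
Qed.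

Lemma enormE (R : realType) (n : nat) (x : 'rV[R]_n) :
  enorm x = Num.sqrt (dot x x).
Proof. by congr Num.sqrt; apply: eq_bigr => i _; rewrite expr2. Qed.

Lemma cvg_enorm0 (R : realType) (n : nat) :
  @enorm R n x @[x --> (0 : 'rV[R]_n)] --> (0 : R).
Proof.
have h (x : 'rV[R]_n) : 0 <= enorm x <= n%:R * `|x|.
  rewrite sqrtr_ge0/= -[leRHS](ger0_norm (mulr_ge0 _ _))// -sqrtr_sqr enormE.
  apply: ler_wsqrtr; rewrite (le_trans (ler_norm _))//.
  rewrite (le_trans (dot_le_norm _ _))// exprMn expr2 -mulrA -expr2.
  rewrite ler_wpM2r ?sqr_ge0//.
  by rewrite -natrM ler_nat; case: n {x} => // k; rewrite leq_pmulr.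
apply: (@squeeze_cvgr _ (nbhs (0 : 'rV[R]_n)) _ _ (cst 0)
  (fun x : 'rV[R]_n => n%:R * `|x|)).
- exact: nearW h.
- exact: cvg_cst.
- rewrite -[X in _ --> X](mulr0 n%:R); apply: cvgMl_tmp.
  rewrite -[X in _ --> X](@normr0 _ 'rV[R]_n).
  by apply: cvg_norm; exact: cvg_id.
Qed.

(** * The solutions *)

Lemma punctured_open (R : realType) (n : nat) :
  open (~` [set (0 : 'rV[R]_n)]).
Proof.
apply/closed_openC/accessible_closed_set1/hausdorff_accessible.
exact: norm_hausdorff.
Qed.

(** All but finitely many centres are far from [x], and the remaining [rho j]
    have a positive lower bound. *)
Lemma uniformly_tame_punctured (R : realType) (n : nat) (rho : nat -> R)
    (c : nat -> 'rV[R]_n) (x : 'rV[R]_n) :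
  (forall j, 0 < rho j <= 1) -> (forall j, `|c j| <= 1) ->
  (fun j => `|c j|) @ \oo --> (0 : R) -> x != 0 -> uniformly_tame rho c x.
Proof.
move=> rho01 c1 c0 x0.
have x20 : 0 < `|x| / 2 by rewrite divr_gt0 ?normr_gt0.
have [N _ hN] : \forall j \near \oo, `|c j| <= `|x| / 2.
  apply: filterS (cvgr0_norm_le _ c0 _ x20) => j.
  by rewrite normr_id.
have [r r0 hr] := finite_lower_bound N (fun j => proj1 (andP (rho01 j))).
apply: (@uniformly_tame_separated _ _ _ _ _ _ (Num.min r (`|x| / 2))) => //.
- by rewrite lt_min r0.
- by move=> j; have /andP[/ltW -> ->] := rho01 j.
- move=> j; have [jN|Nj] := ltnP j N; [left|right].
    by rewrite ge_min hr.
  rewrite ge_min; apply/orP; right.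
  by have := hN j Nj; have := lerB_dist x (c j); rewrite /=; lra.
Qed.

Lemma uniformly_tame_centered (R : realType) (n : nat) (x : 'rV[R]_n) :
  x != 0 -> uniformly_tame (fun _ : unit => 0) (fun _ : unit => 0) x.
Proof.
move=> x0; apply: (@uniformly_tame_separated _ _ _ _ _ _ `|x|).
- by rewrite normr_gt0.
- by move=> _; rewrite lexx ler01.
- by move=> _; rewrite normr0 ler01.
- by move=> _; right; rewrite subr0.
Qed.

Lemma reval_continuous (R : realType) (n : nat) (e : rexpr R n)
    (x : 'rV[R]_n) :
  x != 0 -> {for x, continuous (reval e 0)}.
Proof.
move=> /uniformly_tame_centered/(uniformly_tame_lipschitz e)[eta [C [eta0 hC]]].
apply: (continuous_of_lipschitz (C := C) eta0) => w weta.
by have := hC tt w weta; rewrite !subr0.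
Qed.

Lemma reval_is_derive (R : realType) (n : nat) (e : rexpr R n) (k : 'I_n)
    (x : 'rV[R]_n) :
  x != 0 ->
  is_derive x (delta_mx ord0 k) (reval e 0)
    (reval (rdir (delta_mx ord0 k) e) 0 x).
Proof.
move=> /uniformly_tame_centered/(uniformly_tame_taylor e k)[eta [C [eta0 hC]]].
apply: (is_derive_of_taylor (C := C) eta0) => h heta.
by have := hC tt h heta; rewrite !subr0.
Qed.

(** The rate [4^-j] beats the weights [2^-j] of the bubbles. *)
Lemma small_psi_sequence (R : realType) (psi : R -> R) :
  psi r @[r --> 0^'+] --> 0 ->
  exists d : nat -> R, forall j,
    0 < d j < 2^-1 ^+ j /\ `|psi (d j)| <= 2^-1 ^+ j * 2^-1 ^+ j.
Proof.
move=> psi0; suff /choice[d hd] : forall j : nat, exists d : R,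
    0 < d < 2^-1 ^+ j /\ `|psi d| <= 2^-1 ^+ j * 2^-1 ^+ j by exists d.
move=> j.
have q0 : 0 < 2^-1 ^+ j :> R by rewrite exprn_gt0// invr_gt0.
have : \forall d \near 0^'+, 0 < d < 2^-1 ^+ j /\
    `|psi d| <= 2^-1 ^+ j * 2^-1 ^+ j.
  near=> d; split.
    by apply/andP; split; near: d; [exact: nbhs_right_gt|exact: nbhs_right_lt].
  by near: d; apply: cvgr0_norm_le => //; rewrite mulr_gt0.
exact: filter_ex.
Unshelve. all: by end_near. Qed.

Lemma exists_half_pow_lt (R : realType) (r : R) :
  0 < r -> exists j : nat, 2^-1 ^+ j < r.
Proof.
move=> r0.
have h : (fun j => (2^-1 : R) ^+ j) @ \oo --> (0 : R).
  by apply: cvg_expr; rewrite ger0_norm ?invr_ge0// invf_lt1// ltr1n.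
have [j] := filter_ex (cvgr0_norm_lt _ h _ r0).
rewrite ger0_norm ?exprn_ge0 ?invr_ge0// => hj.
by exists j.
Qed.

(** The added constant keeps [v^lambda] from decaying at infinity faster than the
    sources of the bubbles. *)
Lemma fundamental_solution (R : realType) (n : nat) : (3 <= n)%N ->
  let v := reval (RAdd (RConst 1) (RPow (- ((n%:R - 2) / 2)))) 0
           : 'rV[R]_n -> R in
  [/\ smooth_on (~` [set 0]) v,
      forall x, x != 0 -> laplacian v x = 0 &
      v x * enorm x ^+ (n - 2) @[x --> (0 : 'rV[R]_n)^'] --> (1 : R)].
Proof.
move=> n3 v.
have cF (e : rexpr R n) (x : 'rV[R]_n) :
    (~` [set 0]) x -> {for x, continuous (reval e 0)}.
  by move=> /eqP; exact: reval_continuous.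
have dF (e : rexpr R n) (i : 'I_n) (x : 'rV[R]_n) :
    (~` [set 0]) x -> is_derive x (delta_mx ord0 i) (reval e 0)
      (reval (rdir (delta_mx ord0 i) e) 0 x).
  by move=> /eqP; exact: reval_is_derive.
split.
- exact: (smooth_on_family (@punctured_open R n) cF dF).
- move=> x x0; have s0 := dot_gt0 x0.
  rewrite (laplacian_family (@punctured_open R n) dF); last exact/eqP.
  transitivity (\sum_(i < n) reval (rdir (delta_mx ord0 i)
      (rdir (delta_mx ord0 i) (RPow (- ((n%:R - 2) / 2))))) 0 x).
    by apply: eq_bigr => i _ /=; rewrite add0r.
  rewrite laplacian_RPow ?add0r// mulr0 add0r.
  rewrite (_ : n%:R + 2 * (- ((n%:R - 2) / 2) - 1) = 0); last by field.
  by rewrite mul0r mulr0 mul0r.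
- have E : (\forall x \near (0 : 'rV[R]_n)^',
      1 + enorm x ^+ (n - 2) = v x * enorm x ^+ (n - 2)).
    near=> x.
    have x0 : x != 0 by near: x; exact: nbhs_dnbhs_neq.
    have s0 := dot_gt0 x0.
    rewrite /v /= add0r mulrDl mul1r addrC; congr (_ + _).
    rewrite enormE -powR12_sqrt ?(ltW s0)// -powR_mulrn ?powR_ge0//.
    rewrite -powRrM natrB ?(leq_trans _ n3)// mulrC [2^-1 * _]mulrC.
    by rewrite powRN divff// gt_eqF// powR_gt0.
  have L : 1 + enorm x ^+ (n - 2) @[x --> (0 : 'rV[R]_n)^'] -->
      (1 + 0 ^+ (n - 2) : R).
    apply: cvgD; first exact: cvg_cst.
    apply: (@cvg_comp _ _ _ (@enorm R n) (fun r => r ^+ (n - 2))).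
      apply: cvg_trans (@cvg_enorm0 R n).
      by apply: cvg_app; exact: nbhs_dnbhs.
    exact: exprn_continuous.
  rewrite expr0n subn_eq0 leqNgt n3 addr0 in L.
  exact: cvg_trans (near_eq_cvg E) L.
Unshelve. all: by end_near. Qed.

Lemma dot_scale_delta (R : realType) (n : nat) (d : R) (i : 'I_n) :
  dot (d *: delta_mx ord0 i) (d *: delta_mx ord0 i : 'rV[R]_n) = d ^+ 2.
Proof. by rewrite dotZr dotC dotZr dot_delta mxE !eqxx mulr1 expr2. Qed.

(** The weights sum to the inverse of [n (n-2) 4^(b lambda)]; by
    [bubble_laplacian_bound] the sources of the bubbles then add up to at most
    [(1 + |x|^(2-n))^lambda].  For the lower bound at a centre,
    a single bubble suffices since the others are positive. *)
Lemma bubble_superposition (R : realType) (n : nat) (lambda : R)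
    (d : nat -> R) (i0 : 'I_n) :
  (3 <= n)%N -> n%:R / (n%:R - 2) < lambda ->
  (forall j, 0 < d j < 2^-1 ^+ j) ->
  exists (u : 'rV[R]_n -> R) (kappa : R),
  [/\ 0 < kappa,
      smooth_on (~` [set 0]) u,
      forall x, x != 0 -> 0 < u x,
      forall x, x != 0 ->
        0 <= - laplacian u x <=
          (1 + dot x x `^ (- ((n%:R - 2) / 2))) `^ lambda &
      forall j, kappa * 2^-1 ^+ j *
          d j `^ (- ((n%:R - 2) ^+ 2 / n%:R * lambda)) <=
        u (d j *: delta_mx ord0 i0)].
Proof.
move=> n3 hl hd.
have N3 : 3 <= n%:R :> R by rewrite (ler_nat R 3).
have N0 : 0 < n%:R :> R by lra.
have N2 : 0 < n%:R - 2 :> R by lra.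
have n0 : (0 < n)%N by exact: leq_trans n3.
set b := (n%:R - 2) / 2.
have b0 : 0 < b by rewrite divr_gt0.
have nb : n%:R = 2 * (b + 1) by rewrite /b; field.
have l0 : 0 < lambda by apply: lt_trans hl; rewrite divr_gt0.
have nbl : n%:R / 2 <= b * lambda.
  rewrite ltW// /b mulrAC ltr_pM2r// mulrC.
  by rewrite -ltr_pdivrMr.
have d0 j : 0 < d j by have /andP[] := hd j.
have d1 j : d j <= 1.
  have /andP[_ /ltW dj] := hd j; rewrite (le_trans dj)// exprn_ile1//.
  by rewrite invf_le1// ler1n.
pose p := b * lambda.
have p0 : 0 < p by rewrite mulr_gt0.
pose rho j := d j `^ (4 * p / n%:R).
pose c j : 'rV[R]_n := d j *: delta_mx ord0 i0.
have rho0 j : 0 < rho j by rewrite powR_gt0.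
pose kappa := (n%:R * (n%:R - 2) * 4 `^ p)^-1.
have kappa0 : 0 < kappa by rewrite invr_gt0 !mulr_gt0// powR_gt0.
pose eps : nat -> R := geometric (kappa / 2) 2^-1.
have epsE j : eps j = kappa / 2 * 2^-1 ^+ j by [].
have eps0 j : 0 < eps j by rewrite epsE mulr_gt0 ?exprn_gt0 ?divr_gt0// invr_gt0.
have eps0' j : 0 <= eps j by exact: ltW.
have epscvg : series eps @ \oo --> kappa.
  have -> : kappa = kappa / 2 * (1 - 2^-1)^-1 by field.
  by apply: cvg_geometric_series; rewrite ger0_norm ?invr_ge0// invf_lt1// ltr1n.
have ceps : cvgn (series eps) by apply/cvg_ex; exists kappa.
have leps : limn (series eps) = kappa by exact: cvg_lim epscvg.
have cnorm j : `|c j| <= d j.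
  rewrite normrZ (ger0_norm (ltW (d0 j))) ler_piMr ?(ltW (d0 j))//.
  exact: norm_delta_le1.
have tm (x : 'rV[R]_n) : x != 0 -> uniformly_tame rho c x.
  apply: uniformly_tame_punctured => [j|j|].
  - rewrite rho0/=; apply: (@le_trans _ _ (1 `^ (4 * p / n%:R)));
      last by rewrite powR1.
    apply: ge0_ler_powR; rewrite ?nnegrE ?(ltW (d0 j)) ?ler01//.
    by rewrite divr_ge0 ?mulr_ge0// ltW.
  - exact: le_trans (cnorm j) (d1 j).
  - apply: (@squeeze_cvgr _ _ _ _ (cst 0) (fun j => (2^-1 : R) ^+ j)).
    + apply: nearW => j /=; rewrite normr_ge0 (le_trans (cnorm j))//.
      by have /andP[_ /ltW] := hd j.
    + exact: cvg_cst.
    + by apply: cvg_expr; rewrite ger0_norm ?invr_ge0// invf_lt1// ltr1n.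
have tmn (x : 'rV[R]_n) : x != 0 -> \forall y \near x, uniformly_tame rho c y.
  move=> x0; apply: filterS (open_nbhs_nbhs (conj (@punctured_open R n) _)).
    by move=> y /eqP; exact: tm.
  exact/eqP.
pose F := superpose eps rho c.
have cF (e : rexpr R n) (x : 'rV[R]_n) :
    (~` [set 0]) x -> {for x, continuous (F e)}.
  by move=> /eqP x0; apply: superpose_continuous => //; exact: tmn.
have dF (e : rexpr R n) (i : 'I_n) (x : 'rV[R]_n) : (~` [set 0]) x ->
    is_derive x (delta_mx ord0 i) (F e) (F (rdir (delta_mx ord0 i) e) x).
  by move=> /eqP x0; apply: superpose_is_derive => //; exact: tmn.
have ucvg x : x != 0 -> cvgn (series (fun j =>
    eps j * reval (RPow (- b)) (rho j) (x - c j))).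
  by move=> x0; apply: superpose_cvg => //; exact: tm.
have B0 j (y : 'rV[R]_n) : 0 < rho j + dot y y by rewrite ltr_wpDr// dot_ge0.
have term_le j x : x != 0 ->
    eps j * (rho j + dot (x - c j) (x - c j)) `^ (- b) <= F (RPow (- b)) x.
  move=> x0; apply: (@term_le_lim_series _
    (fun j => eps j * reval (RPow (- b)) (rho j) (x - c j)) j); last exact: ucvg.
  by move=> i; rewrite mulr_ge0// powR_ge0.
have cdot j : dot (c j) (c j) = d j ^+ 2 by exact: dot_scale_delta.
exists (F (RPow (- b))), (kappa / 2); split.
- by rewrite divr_gt0.
- exact: (smooth_on_family (@punctured_open R n) cF dF).
- by move=> x x0; apply: lt_le_trans (term_le 0 x x0); rewrite mulr_gt0// powR_gt0.
- move=> x x0.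
  rewrite (laplacian_family (@punctured_open R n) dF); last exact/eqP.
  rewrite superpose_sum//; last exact: tm.
  pose a j := eps j * (n%:R * (n%:R - 2) *
    (rho j * (rho j + dot (x - c j) (x - c j)) `^ (- b - 2))).
  rewrite (_ : (fun j => eps j * _) = - a); last first.
    apply/funext => j; rewrite laplacian_RPow// /a !fctE.
    rewrite (_ : n%:R + 2 * (- b - 1) = 0); last by rewrite nb; ring.
    by rewrite /b; field.
  set V := (1 + _) `^ lambda.
  have a0 j : 0 <= a j.
    apply: mulr_ge0 => //; apply: mulr_ge0; first by rewrite ltW// mulr_gt0.
    by rewrite mulr_ge0 ?powR_ge0// ltW.
  have aV j : `|a j| <= V / kappa * eps j.
    rewrite (ger0_norm (a0 j)) /a mulrC ler_wpM2r// /kappa invrK [leRHS]mulrC.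
    rewrite -[leRHS]mulrA ler_wpM2l ?mulr_ge0 ?(ltW N0) ?(ltW N2)//.
    by apply: (@bubble_laplacian_bound _ n b lambda (d j)) => //; exact: ltW.
  have [ca la] := dominated_series eps0' aV ceps.
  rewrite leps divfK ?gt_eqF// in la.
  rewrite lim_seriesN// opprK (le_trans (ler_norm _) la) andbT.
  apply: limr_ge => //; apply: nearW => N.
  by apply: sumr_ge0 => j _.
- move=> j; have cj0 : c j != 0.
    apply: contraTneq (d0 j) => cj; have := cdot j.
    rewrite cj /dot big1 => [/esym/eqP|i _]; last by rewrite mxE mul0r.
    by rewrite sqrf_eq0 => /eqP ->; rewrite ltxx.
  apply: le_trans (term_le j _ cj0).
  rewrite subrr epsE (_ : dot 0 0 = 0); last first.
    by rewrite /dot big1// => i _; rewrite mxE mul0r.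
  rewrite addr0 /rho -powRrM.
  rewrite (_ : 4 * p / n%:R * - b = - ((n%:R - 2) ^+ 2 / n%:R * lambda))//.
  by rewrite /p /b; field; rewrite gt_eqF.
Qed.

Theorem theorem3p3 (R : realType) (n : nat) (lambda sigma : R) (psi : R -> R)
    (hn : (3 <= n)%N)
    (hlambda : n%:R / (n%:R - 2) < lambda)
    (hsigma : sigma < 2 / (n%:R - 2) + n%:R / (n%:R - 2) * (1 / lambda))
    (hpsi01 : forall r : R, 0 < r < 1 -> 0 < psi r < 1)
    (hpsi_cont : {within `]0, 1[, continuous psi})
    (hpsi_lim : psi r @[r --> 0^'+] --> 0) :
  exists u v : 'rV[R]_n -> R,
    [/\ smooth_on (~` [set 0]) u /\ smooth_on (~` [set 0]) v,
        forall x : 'rV[R]_n, x != 0 -> 0 < u x /\ 0 < v x,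
        forall x : 'rV[R]_n, x != 0 ->
          0 <= - laplacian u x <= v x `^ lambda /\
          0 <= - laplacian v x <= u x `^ sigma,
        ~ (u =O_ ((0 : 'rV[R]_n)^')
             (fun x : 'rV[R]_n => psi (enorm x) *
                enorm x `^ (- ((n%:R - 2) ^+ 2 / n%:R * lambda)))) &
        v x * enorm x ^+ (n - 2) @[x --> (0 : 'rV[R]_n)^'] --> (1 : R)].
Proof.
have [d hd] := small_psi_sequence hpsi_lim.
have hd1 j : 0 < d j < 2^-1 ^+ j by have [] := hd j.
pose i0 : 'I_n := Ordinal (leq_trans (isT : (0 < 3)%N) hn).
have [u [kappa [kappa0 us up ul ub]]] := bubble_superposition i0 hn hlambda hd1.
have [vs vl vc] := fundamental_solution R hn.
set v := reval _ 0 in vs vl vc.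
have vE x : v x = 1 + dot x x `^ (- ((n%:R - 2) / 2)) by rewrite /v /= add0r.
exists u, v; split => //.
- by move=> x x0; rewrite up// vE ltr_wpDr// powR_ge0.
- by move=> x x0; rewrite vl// oppr0 lexx powR_ge0 vE; split=> //; exact: ul.
- move=> /eqO_exP[k k0].
  rewrite /dnbhs => /nbhs_ballP[r /= r0 hr].
  (* The supposed bound at [x = c_j] reads [kappa 2^-j <= k 4^-j]; it fails as soon
     as [2^-j < kappa / k]. *)
  have [j jr] : exists j : nat, (2^-1 : R) ^+ j < Num.min r (kappa / k).
    by apply: exists_half_pow_lt; rewrite lt_min r0 divr_gt0.
  move: jr; rewrite lt_min => /andP[jr jk].
  have /andP[dj0 djq] := hd1 j; have [_ psij] := hd j.
  set x : 'rV[R]_n := d j *: delta_mx ord0 i0.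
  have xd : dot x x = d j ^+ 2 by exact: dot_scale_delta.
  have ex : enorm x = d j by rewrite enormE xd sqrtr_sqr ger0_norm// ltW.
  have x0 : x != 0.
    apply: contraTneq dj0 => xe; rewrite -ex xe enormE /dot big1 ?sqrtr0 ?ltxx//.
    by move=> i _; rewrite mxE mul0r.
  have xr : ball (0 : 'rV[R]_n) r x.
    rewrite -ball_normE/= sub0r normrN (le_lt_trans _ (lt_trans djq jr))//.
    rewrite normrZ (ger0_norm (ltW dj0)) ler_piMr ?(ltW dj0)//.
    exact: norm_delta_le1.
  have := hr x xr x0; rewrite ex => ux.
  have := le_trans (ub j) (le_trans (ler_norm _) ux).
  set D := d j `^ _; have D0 : 0 < D by rewrite powR_gt0.
  rewrite normrM (ger0_norm (ltW D0)) mulrA ler_pM2r//.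
  have q0 : 0 < (2^-1 : R) ^+ j by rewrite exprn_gt0// invr_gt0.
  move=> h; have := le_trans h (ler_wpM2l (ltW k0) psij).
  rewrite mulrA ler_pM2r// => h2.
  by move: jk; rewrite ltr_pdivlMr// mulrC ltNge h2.
Qed.
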